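(* Let $\rho>0$. Consider the hierarchical optimization problem over a tree network with $D$ levels, written in layered form as $\min \sum_{d=1}^D f_d(x_d)$ subject to $A_dx_d+B_dx_{d+1}=c_d$ for $d=1,\dots,D-1$, where $f_d,A_d,B_d,c_d$ are built from the tree as described in the context. Assume that the problem has a strictly feasible point (Slater's condition) and admits an optimal solution. Suppose that $f_1,\dots,f_D$ are differentiable and strongly convex with moduli $\alpha_d>0$, i.e. for each $d$ and all $z,z'\in\mathrm{Dom}(f_d)$, $$f_d(z)-f_d(z')\ \ge\ \nabla f_d(z')^\top(z-z')+\alpha_d\|z-z'\|_2^2 .$$ Then the primal sequence $\{[x_d^k]_{d=1}^D\}_k$ generated by the hADMM algorithm with penalty parameter $\rho$ converges to the unique minimizer $[x_d^\star]_{d=1}^D$ of the problem.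
   Context: **Tree problem.** A rooted tree has levels $d=1,\dots,D$ ($D\ge 2$); node $(d,i)$ is the $i$-th node at level $d$, and $(1,1)$ is the only node at level 1 (the root). Each non-root node at level $d+1$ has exactly one parent, at level $d$. $\mathcal C_{d,i}$ is the set of indices $j$ such that $(d+1,j)$ is a child of $(d,i)$; $\mathcal P_d$ is the index set of nodes at level $d$ with at least one child (parents) and $\mathcal L_d$ the index set of nodes at level $d$ with no child (leaves). Node $(d,i)$ has a variable $x_{d,i}\in\mathbb R^{n_{d,i}}$ and a finite-valued convex cost $f_{d,i}:\mathbb R^{n_{d,i}}\to\mathbb R$. The hierarchical optimization problem minimizes $\sum_{d=1}^D\sum_{i\in\mathcal P_d\cup\mathcal L_d}f_{d,i}(x_{d,i})$ subject to $A_{d,ij}x_{d,i}+B_{d,ij}x_{d+1,j}=c_{d,ij}$ for all $d\in\{1,\dots,D-1\}$, $i\in\mathcal P_d$, $j\in\mathcal C_{d,i}$, with given $A_{d,ij}\in\mathbb R^{s_{d,ij}\times n_{d,i}}$, $B_{d,ij}\in\mathbb R^{s_{d,ij}\times n_{d+1,j}}$, $c_{d,ij}\in\mathbb R^{s_{d,ij}}$. **Layered form.** $x_d\in\mathbb R^{n_d}$ stacks all $x_{d,i}$, $i\in\mathcal P_d$, followed by all $x_{d,i}$, $i\in\mathcal L_d$; $f_d(x_d)=\sum_{i\in\mathcal P_d\cup\mathcal L_d}f_{d,i}(x_{d,i})$. For $i\in\mathcal P_d$, $A_{d,i}$ is the vertical stack of $A_{d,ij}$, $j\in\mathcal C_{d,i}$;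 $B_{d,i}$ is the block-diagonal matrix of $B_{d,ij}$, $j\in\mathcal C_{d,i}$; $c_{d,i}$ is the stack of $c_{d,ij}$. Then $A_d=[\mathrm{blockdiag}(A_{d,i})_{i\in\mathcal P_d},\ 0]\in\mathbb R^{s_d\times n_d}$, $B_d=\mathrm{blockdiag}(B_{d,i})_{i\in\mathcal P_d}M_d\in\mathbb R^{s_d\times n_{d+1}}$, $c_d$ is the stack of $c_{d,i}$, $i\in\mathcal P_d$, where $s_d=\sum_{i\in\mathcal P_d}\sum_{j\in\mathcal C_{d,i}}s_{d,ij}$ and $M_d$ is the permutation matrix with $[[x_{d+1,j}]_{j\in\mathcal C_{d,i}}]_{i\in\mathcal P_d}=M_dx_{d+1}$. The tree problem is exactly the layered problem in the claim. **hADMM.** The augmented Lagrangian is $$L(x_1,\dots,x_D;y_1,\dots,y_{D-1})=f_D(x_D)+\sum_{d=1}^{D-1}\Big(f_d(x_d)+y_d^\top(A_dx_d+B_dx_{d+1}-c_d)+\tfrac{\rho}{2}\|A_dx_d+B_dx_{d+1}-c_d\|_2^2\Big),$$ with $y_d\in\mathbb R^{s_d}$. From an arbitrary initial point $([x_d^0]_d,[y_d^0]_d)$, iteration $k$ ($k=0,1,2,\dots$, run without stopping) computes, for $d=1,2,\dots,D$ in this order (forward pass), $$x_d^{k+1}=\arg\min_{x_d}L(x_1^{k+1},\dots,x_{d-1}^{k+1},x_d,x_{d+1}^k,\dots,x_D^k;y_1^k,\dots,y_{D-1}^k),$$ and then (backward pass) $y_d^{k+1}=y_d^k+\rho(A_dx_d^{k+1}+B_dx_{d+1}^{k+1}-c_d)$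 for $d=D-1,\dots,1$. (The paper's Algorithm 1 is a distributed implementation of these passes over the tree.) *)

(* Defs.v *)
From HB Require Import structures.
From mathcomp Require Import all_boot all_order all_algebra.
From mathcomp Require Import all_classical all_reals all_analysis.
Set Implicit Arguments.
Unset Strict Implicit.
Unset Printing Implicit Defensive.
Import Order.TTheory GRing.Theory Num.Theory.
Import numFieldNormedType.Exports.
Local Open Scope classical_set_scope.
Local Open Scope ring_scope.

(* Levels are numbered from 0: level [d] below is level d+1 of the usual
   1-based numbering, so the root is the only node of level 0 and the deepest
   level is [D.-1].  Families over levels are indexed by all of [nat]; since
   levels [d >= D] have no node, they carry only empty (zero-dimensional)
   data. *)
Record tree (D : nat) := Tree {
  width : nat -> nat;
  parent : forall d, 'I_(width d.+1) -> 'I_(width d);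
  width_root : width 0 = 1%N;
  width_gt0 : forall d, (0 < width d)%N = (d < D)%N }.

Section TreeSets.
Variables (D : nat) (T : tree D).

Definition node d := 'I_(width T d).

Definition children d (i : node d) : {set node d.+1} :=
  [set j : node d.+1 | parent j == i].

Definition parents d : {set node d} :=
  [set i : node d | children i != finset.set0].

Definition leaves d : {set node d} :=
  [set i : node d | children i == finset.set0].

End TreeSets.
Arguments parents {D} T d.
Arguments leaves {D} T d.

(* [edgeA], [edgeB], [edgec] are only ever used at pairs (i, j) with
   [j \in children i]. *)
Record tree_problem (R : realType) (D : nat) := TreeProblem {
  ptree :> tree D;
  ndim : forall d, node ptree d -> nat;
  sdim : forall d, node ptree d -> node ptree d.+1 -> nat;
  ncost : forall d (i : node ptree d), 'cV[R]_(ndim i) -> R^o;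
  ncost_convex : forall d (i : node ptree d),
    convex_function [set: 'cV[R]_(ndim i)] (@ncost d i);
  edgeA : forall d (i : node ptree d) (j : node ptree d.+1),
    'M[R]_(sdim i j, ndim i);
  edgeB : forall d (i : node ptree d) (j : node ptree d.+1),
    'M[R]_(sdim i j, ndim j);
  edgec : forall d (i : node ptree d) (j : node ptree d.+1),
    'cV[R]_(sdim i j) }.

(* Rectangular-block variant of [\mxdiag]; the [conform_mx] is the identity on
   the diagonal, where the two types agree. *)
Definition blockdiag (V : nmodType) m (p q : 'I_m -> nat)
    (F : forall i, 'M[V]_(p i, q i)) : 'M[V]_(\sum_i p i, \sum_i q i) :=
  \mxblock_(i, j) (if i == j then conform_mx 0 (F i) else 0).

Definition dot (R : realType) n (u v : 'cV[R]_n) : R := (u^T *m v) 0 0.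

Definition sqnorm2 (R : realType) n (v : 'cV[R]_n) : R := dot v v.

Definition gradient (R : realType) n (f : 'cV[R]_n -> R^o) (z : 'cV[R]_n) :
    'cV[R]_n :=
  \col_i ('D_(delta_mx i 0) f z).

Lemma blockdiagM (K : pzSemiRingType) m (p q : 'I_m -> nat)
    (F : forall i, 'M[K]_(p i, q i)) (v : forall i, 'cV[K]_(q i)) :
  blockdiag F *m (\mxcol_i v i) = \mxcol_i (F i *m v i).
Proof.
rewrite /blockdiag mxblockEv mxcol_mul; apply/eq_mxcolP => i.
rewrite mul_mxrow_mxcol.
rewrite (bigD1 i) //= eqxx conform_mx_id big1 ?addr0 // => j.
by rewrite eq_sym => /negPf->; rewrite mul0mx.
Qed.

Section Layered.
Variables (R : realType) (D : nat) (Q : tree_problem R D).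

Definition par d (k : 'I_#|parents Q d|) : node Q d := enum_val k.
Definition lf d (k : 'I_#|leaves Q d|) : node Q d := enum_val k.
Definition ch d (i : node Q d) (k : 'I_#|children i|) : node Q d.+1 :=
  enum_val k.

Definition pdim d := (\sum_(k < #|parents Q d|) ndim (par k))%N.
Definition ldim d := (\sum_(k < #|leaves Q d|) ndim (lf k))%N.

Definition layer_dim d : nat := (pdim d + ldim d)%N.

Definition cdim d (i : node Q d) : nat :=
  (\sum_(k < #|children i|) sdim i (ch k))%N.

Definition layer_sdim d : nat := (\sum_(k < #|parents Q d|) cdim (par k))%N.

Definition layer_stack d (x : forall i : node Q d, 'cV[R]_(ndim i)) :
    'cV[R]_(layer_dim d) :=
  col_mx (\mxcol_(k < #|parents Q d|) x (par k))
         (\mxcol_(k < #|leaves Q d|) x (lf k)).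

Definition layer_cost d (x : 'cV[R]_(layer_dim d)) : R^o :=
  \sum_(k < #|parents Q d|)
     ncost (submxcol (usubmx x : 'cV[R]_(\sum_k ndim (par k))) k) +
  \sum_(k < #|leaves Q d|)
     ncost (submxcol (dsubmx x : 'cV[R]_(\sum_k ndim (lf k))) k).

Definition nodeA d (i : node Q d) : 'M[R]_(cdim i, ndim i) :=
  \mxcol_(k < #|children i|) edgeA i (ch k).

Definition nodeB d (i : node Q d) :
    'M[R]_(cdim i, \sum_(k < #|children i|) ndim (ch k)) :=
  blockdiag (fun k : 'I_#|children i| => edgeB i (ch k)).

Definition nodec d (i : node Q d) : 'cV[R]_(cdim i) :=
  \mxcol_(k < #|children i|) edgec i (ch k).

Definition layerA d : 'M[R]_(layer_sdim d, layer_dim d) :=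
  row_mx (blockdiag (fun k : 'I_#|parents Q d| => nodeA (par k)))
         (0 : 'M[R]_(layer_sdim d, ldim d)).

(* 0/1 matrix extracting the block of node [j] from a stacked layer vector. *)
Definition node_sel d (j : node Q d) : 'M[R]_(ndim j, layer_dim d) :=
  row_mx
    (\mxrow_(k < #|parents Q d|)
       if par k == j then conform_mx 0 (1%:M : 'M[R]_(ndim j)) else 0)
    (\mxrow_(k < #|leaves Q d|)
       if lf k == j then conform_mx 0 (1%:M : 'M[R]_(ndim j)) else 0).

(* The permutation matrix M_d, regrouping the blocks of the layer [d.+1] by
   parent; its row and column dimensions are equal but not convertible.
   It is pinned down by [layerM_stack] below. *)
Definition layerM d :
    'M[R]_(\sum_(k < #|parents Q d|) \sum_(l < #|children (par k)|) ndim (ch l),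
           layer_dim d.+1) :=
  \mxcol_(k < #|parents Q d|) \mxcol_(l < #|children (par k)|) node_sel (ch l).

Lemma node_sel_stack d (x : forall i : node Q d, 'cV[R]_(ndim i)) j :
  node_sel j *m layer_stack x = x j.
Proof.
have selK k (c : 'I_k -> node Q d) :
    (\mxrow_l if c l == j then conform_mx 0 (1%:M : 'M[R]_(ndim j)) else 0) *m
      (\mxcol_l x (c l)) = \sum_(l | c l == j) x j.
  rewrite mul_mxrow_mxcol [RHS]big_mkcond /=; apply: eq_bigr => l _.
  case: eqVneq => [e|_]; last by rewrite mul0mx.
  by rewrite -e conform_mx_id mul1mx.
have selA (A : {set node Q d}) :
    \sum_(l < #|A| | enum_val l == j) x j = if j \in A then x j else 0.
  rewrite -(big_enum_val_cond (A := pred_of_set A) (pred1 j) (fun=> x j)) /=.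
  case: ifP => jA; last first.
    by rewrite big1 // => i /andP[iA /eqP ij]; rewrite -ij iA in jA.
  rewrite (bigD1 j) ?jA ?eqxx //= big1 ?addr0 // => i.
  by case/andP=> /andP[_ /eqP->]; rewrite eqxx.
rewrite mul_row_col !selK !selA !inE.
by case: eqP => _; rewrite /= (add0r, addr0).
Qed.

Lemma layerM_stack d (x : forall i : node Q d.+1, 'cV[R]_(ndim i)) :
  layerM d *m layer_stack x =
  \mxcol_(k < #|parents Q d|) \mxcol_(l < #|children (par k)|) x (ch l).
Proof.
rewrite mxcol_mul; apply/eq_mxcolP => k; rewrite mxcol_mul.
by apply/eq_mxcolP => l; rewrite node_sel_stack.
Qed.

Definition layerB d : 'M[R]_(layer_sdim d, layer_dim d.+1) :=
  blockdiag (fun k : 'I_#|parents Q d| => nodeB (par k)) *m layerM d.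

Definition layerc d : 'cV[R]_(layer_sdim d) :=
  \mxcol_(k < #|parents Q d|) nodec (par k).

Definition primal := forall d, 'cV[R]_(layer_dim d).
Definition dual := forall d, 'cV[R]_(layer_sdim d).

Definition residual (x : primal) d : 'cV[R]_(layer_sdim d) :=
  layerA d *m x d + layerB d *m x d.+1 - layerc d.

Definition objective (x : primal) : R := \sum_(d < D) layer_cost (x d).

Definition feasible (x : primal) : Prop :=
  forall d, (d < D.-1)%N ->
    layerA d *m x d + layerB d *m x d.+1 = layerc d.

(* Slater: feasible and in the interior of the domain of the objective.  The
   costs are finite everywhere, so these domains are the whole spaces. *)
Definition strictly_feasible (x : primal) : Prop :=
  feasible x /\
  forall d, (d < D)%N -> interior [set: 'cV[R]_(layer_dim d)] (x d).

Definition stack (x : forall d (i : node Q d), 'cV[R]_(ndim i)) : primal :=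
  fun d => layer_stack (x d).

Lemma objective_stack x :
  objective (stack x) = \sum_(d < D) \sum_(i : node Q d) ncost (x d i).
Proof.
apply: eq_bigr => d _; rewrite /layer_cost col_mxKu col_mxKd.
rewrite [RHS](bigID (mem (parents Q d))) /=; congr (_ + _).
  rewrite [RHS]big_enum_val; apply: eq_bigr => k _.
  by rewrite mxcolK.
rewrite [RHS](eq_bigl (mem (leaves Q d))) => [|i]; last by rewrite !inE negbK.
rewrite [RHS]big_enum_val; apply: eq_bigr => k _.
by rewrite mxcolK.
Qed.

Lemma feasible_stack x :
  feasible (stack x) <->
  forall d (i : node Q d) (j : node Q d.+1), j \in children i ->
    edgeA i j *m x d i + edgeB i j *m x d.+1 j = edgec i j.
Proof.
have E d : layerA d *m stack x d + layerB d *m stack x d.+1 =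
   \mxcol_(k < #|parents Q d|) \mxcol_(l < #|children (par k)|)
     (edgeA (par k) (ch l) *m x d (par k) +
      edgeB (par k) (ch l) *m x d.+1 (ch l)).
  rewrite mul_row_col mul0mx addr0 blockdiagM -mulmxA layerM_stack blockdiagM.
  rewrite -mxcolD; apply/eq_mxcolP => k.
  by rewrite blockdiagM mxcol_mul -mxcolD.
split=> [F d i j ij | F d _]; last first.
  rewrite E; apply/eq_mxcolP => k; apply/eq_mxcolP => l.
  exact/F/enum_valP.
have dD : (d < D.-1)%N.
  by have := width_gt0 Q d.+1; rewrite (leq_trans _ (ltn_ord j)) // -ltn_predRL;
     case: D.
have iP : i \in parents Q d by rewrite inE; apply/finset.set0Pn; exists j.
have := F d dD; rewrite E => /mxcolP/(_ (enum_rank_in iP i)).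
rewrite mxcolK /layerc mxcolK.
have -> : par (enum_rank_in iP i) = i by rewrite /par enum_rankK_in.
move=> /mxcolP/(_ (enum_rank_in ij j)); rewrite mxcolK /nodec mxcolK.
by have -> : ch (enum_rank_in ij j) = j by rewrite /ch enum_rankK_in.
Qed.

Definition is_minimizer (x : primal) : Prop :=
  feasible x /\ forall x', feasible x' -> objective x <= objective x'.

Definition aug_lagrangian (rho : R) (x : primal) (y : dual) : R :=
  layer_cost (x D.-1) +
  \sum_(d < D.-1) (layer_cost (x d) + dot (y d) (residual x d) +
                   rho / 2 * sqnorm2 (residual x d)).

(* [eqtype.dfwith x z] replaces the [d]-th component of [x] by [z]. *)
Definition is_block_argmin (rho : R) (x : primal) (y : dual) d
    (z : 'cV[R]_(layer_dim d)) : Prop :=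
  forall z' : 'cV[R]_(layer_dim d),
    aug_lagrangian rho (eqtype.dfwith x z) y <=
    aug_lagrangian rho (eqtype.dfwith x z') y.

(* The initial values [x 0] and [y 0] are arbitrary. *)
Definition hADMM (rho : R) (x : nat -> primal) (y : nat -> dual) : Prop :=
  forall k,
    (forall d, (d < D)%N ->
       is_block_argmin rho
         (fun e => if (e < d)%N then x k.+1 e else x k e) (y k) (x k.+1 d)) /\
    (forall d, (d < D.-1)%N ->
       y k.+1 d = y k d + rho *: residual (x k.+1) d).

(* Convention without the usual factor 1/2 in front of the modulus. *)
Definition strongly_convex d (alpha : R) : Prop :=
  forall z z' : 'cV[R]_(layer_dim d),
    layer_cost z - layer_cost z' >=
      dot (gradient (@layer_cost d) z') (z - z') + alpha * sqnorm2 (z - z').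

End Layered.

(* Main.v *)
Require Import Defs.
From mathcomp Require Import all_boot all_order all_algebra.
From mathcomp Require Import all_classical all_reals all_analysis.
From mathcomp Require Import ring lra.
Set Implicit Arguments.
Unset Strict Implicit.
Unset Printing Implicit Defensive.
Import Order.TTheory GRing.Theory Num.Theory.
Import numFieldNormedType.Exports.
Local Open Scope classical_set_scope.
Local Open Scope ring_scope.

(** The forward pass is a Gauss-Seidel sweep over [D] blocks, but the level [d]
is coupled only to the levels [d - 1] and [d + 1].  Hence the optimality
condition of the [d]-th block update involves the new multiplier
[y_(d-1)^(k+1)] exactly, and [y_d^(k+1)] up to the single error term
[rho B_d (x_(d+1)^(k+1) - x_(d+1)^k)], as in two-block ADMM.  Since the
constraints are affine, the minimizer [xs] has Lagrange multipliers [ys] by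
linear algebra.  Comparing the two stationarity conditions, strong monotonicity
of the gradients shows that
  [V_k = sum_d |y_d^k - ys_d|^2 / (2 rho) + rho / 2 |B_d (x_(d+1)^k - xs_(d+1))|^2]
satisfies
  [V_(k+1) + 2 sum_d alpha_d |x_d^(k+1) - xs_d|^2 <= V_k],
so the squared distances to [xs] are summable in [k]. *)

(** * Euclidean inner product and its comparison with the matrix norm *)

Section Dot.
Context {R : realType}.

Lemma dotE n (u v : 'cV[R]_n) : dot u v = \sum_i u i 0 * v i 0.
Proof. by rewrite /dot mxE; apply: eq_bigr => i _; rewrite mxE. Qed.

Lemma dotC n (u v : 'cV[R]_n) : dot u v = dot v u.
Proof. by rewrite !dotE; apply: eq_bigr => i _; rewrite mulrC. Qed.

Lemma dotDl n (u v w : 'cV[R]_n) : dot (u + v) w = dot u w + dot v w.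
Proof. by rewrite /dot linearD mulmxDl mxE. Qed.

Lemma dotDr n (u v w : 'cV[R]_n) : dot u (v + w) = dot u v + dot u w.
Proof. by rewrite /dot mulmxDr mxE. Qed.

Lemma dotZl n a (u v : 'cV[R]_n) : dot (a *: u) v = a * dot u v.
Proof. by rewrite /dot linearZ -scalemxAl mxE. Qed.

Lemma dotZr n a (u v : 'cV[R]_n) : dot u (a *: v) = a * dot u v.
Proof. by rewrite /dot -scalemxAr mxE. Qed.

Lemma dotNl n (u v : 'cV[R]_n) : dot (- u) v = - dot u v.
Proof. by rewrite -scaleN1r dotZl mulN1r. Qed.

Lemma dotNr n (u v : 'cV[R]_n) : dot u (- v) = - dot u v.
Proof. by rewrite -scaleN1r dotZr mulN1r. Qed.

Lemma dot0l n (u : 'cV[R]_n) : dot 0 u = 0.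
Proof. by rewrite -(scale0r 0) dotZl mul0r. Qed.

Lemma dot0r n (u : 'cV[R]_n) : dot u 0 = 0.
Proof. by rewrite dotC dot0l. Qed.

Lemma sqnorm2_ge0 n (v : 'cV[R]_n) : 0 <= sqnorm2 v.
Proof. by rewrite /sqnorm2 dotE; apply: sumr_ge0 => i _; rewrite -expr2 sqr_ge0. Qed.

Lemma sqr_le_sqnorm2 n (v : 'cV[R]_n) i : v i 0 ^+ 2 <= sqnorm2 v.
Proof.
rewrite /sqnorm2 dotE (bigD1 i) //= expr2 lerDl.
by apply: sumr_ge0 => j _; rewrite -expr2 sqr_ge0.
Qed.

Lemma sqnorm2_eq0 n (v : 'cV[R]_n) : sqnorm2 v <= 0 -> v = 0.
Proof.
move=> v0; apply/colP => i; rewrite mxE; apply/eqP.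
by rewrite -sqrf_eq0 eq_le sqr_ge0 (le_trans (sqr_le_sqnorm2 v i)).
Qed.

(** The norm that defines the topology on column vectors is the max norm, attained at some entry
    unless it is zero. *)
Lemma norm_sqr_le_sqnorm2 n (v : 'cV[R]_n) : `|v| ^+ 2 <= sqnorm2 v.
Proof.
have [v0|v0] := eqVneq `|v| 0; first by rewrite v0 expr0n /= sqnorm2_ge0.
have [[i j] /= vE] := mx_norm_neq0 v0.
have -> : `|v| = `|v i j| by exact: vE.
by rewrite ord1 real_normK ?num_real// sqr_le_sqnorm2.
Qed.

Lemma cvg_sqnorm2 n (u : nat -> 'cV[R]_n) (l : 'cV[R]_n) :
  (fun k => sqnorm2 (u k - l)) @ \oo --> (0 : R) -> u @ \oo --> l.
Proof.
move=> u0; apply/cvgrPdist_lt => e e0.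
have e20 : 0 < e ^+ 2 by rewrite exprn_gt0.
move/cvgr0_norm_lt : u0 => /(_ _ e20); apply: filterS => k.
rewrite ger0_norm ?sqnorm2_ge0// => he.
rewrite distrC -(@ltr_pXn2r _ 2) ?nnegrE ?normr_ge0 ?ltW//.
exact: le_lt_trans (norm_sqr_le_sqnorm2 _) he.
Qed.

(** * Gradients and derivatives along lines *)

Lemma derive_gradient n (f : 'cV[R]_n -> R^o) z h :
  differentiable f z -> 'D_h f z = dot (gradient f z) h.
Proof.
move=> fz; rewrite deriveE//.
have {1}-> : h = \sum_i h i 0 *: delta_mx i 0.
  by rewrite {1}[h]matrix_sum_delta; apply: eq_bigr => i _; rewrite big_ord1.
rewrite linear_sum dotE; apply: eq_bigr => i _.
by rewrite linearZ /= mxE deriveE// mulrC.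
Qed.

Lemma is_derive_line n (f : 'cV[R]_n -> R^o) z h (t : R) :
  differentiable f (z + t *: h) ->
  is_derive t 1 (fun s : R => f (z + s *: h) : R) (dot (gradient f (z + t *: h)) h).
Proof.
move=> fz.
have L : is_diff t (fun s : R => z + s *: h) (fun s : R => s *: h).
  by apply: is_diff_eq; rewrite funeqE => s /=; rewrite !fctE add0r.
have fd : is_diff (z + t *: h) f ('d f (z + t *: h)) by apply: DiffDef.
have C := is_diff_comp L fd.
have D : differentiable (f \o (fun s : R => z + s *: h)) t by exact: ex_diff.
apply: DeriveDef; first exact: diff_derivable D.
rewrite (@deriveE _ _ _ _ _ (1 : R) D) diff_val /= scale1r -deriveE//.
exact: derive_gradient.
Qed.

(** * Summability, and Lagrange multipliers by linear algebra *)

Lemma cvg0_of_bounded_sum (u : R ^nat) (M : R) :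
  (forall k, 0 <= u k) -> (forall n, \sum_(k < n) u k <= M) -> u @ \oo --> (0:R).
Proof.
move=> u0 uM; apply: cvg_series_cvg_0; apply: nondecreasing_is_cvgn.
  by apply: nondecreasing_series => n _ _; exact: u0.
by exists M => _ [n _ <-]; rewrite /series /= big_mkord.
Qed.

(** A vector orthogonal to the common kernel of the [C i] lies in the span of their rows; the
    coefficients are the multipliers. *)
Lemma multipliers n m (s : 'I_m -> nat) (C : forall i, 'M[R]_(s i, n)) (g : 'cV[R]_n) :
  (forall h, (forall i, C i *m h = 0) -> dot g h = 0) ->
  exists y : forall i, 'cV[R]_(s i), forall h,
    dot g h = \sum_i dot (y i) (C i *m h).
Proof.
move=> gC.
have : (g^T <= \mxcol_i C i)%MS.
  (* The columns of the cokernel matrix [K] are killed by every [C i], so the hypothesis makes [g]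
     orthogonal to each of them. *)
  rewrite submxE; move: (cokermx _) (mulmx_coker (\mxcol_i C i)) => K CK.
  apply/eqP/matrixP => i j; rewrite [RHS]mxE ord1.
  transitivity (dot g (K *m delta_mx j 0)).
    by rewrite /dot mulmxA -colE [RHS]mxE.
  apply: gC => k; rewrite mulmxA -(mxcolK C k) submxcol_mul CK.
  by apply/colP => l; rewrite -colE !mxE.
move=> /submxP[u ug]; exists (fun i => (submxrow u i)^T) => h.
rewrite {1}/dot ug -mulmxA mxcol_mul -{1}(submxrowK u) mul_mxrow_mxcol summxE.
by apply: eq_bigr => i _; rewrite /dot trmxK.
Qed.
(** The share of one coupling constraint in [V_k]: [w] stands for the multiplier error, [a] for the
    primal error of the next level seen through [layerB]. *)
Definition edge_energy n (rho : R) (w a : 'cV[R]_n) : R :=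
  sqnorm2 w / (2 * rho) + rho / 2 * sqnorm2 a.

Lemma edge_energy_ge0 n (rho : R) (w a : 'cV[R]_n) :
  0 < rho -> 0 <= edge_energy rho w a.
Proof.
move=> rho0; have rho2 : 0 < 2 * rho by rewrite mulr_gt0.
by rewrite addr_ge0// ?mulr_ge0 ?divr_ge0 ?invr_ge0 ?sqnorm2_ge0// ltW.
Qed.

(* The slack is exactly [rho / 2 * sqnorm2 (r + a - a')], which is why no bound
   on [rho] is needed. *)
Lemma edge_decrease n (rho : R) (w r a a' : 'cV[R]_n) : 0 < rho ->
  - (dot (w + rho *: r - rho *: (a' - a)) (r - a') + dot (w + rho *: r) a') <=
  edge_energy rho w a - edge_energy rho (w + rho *: r) a'.
Proof.
move=> rho0; rewrite -subr_ge0.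
suff -> : edge_energy rho w a - edge_energy rho (w + rho *: r) a' -
    - (dot (w + rho *: r - rho *: (a' - a)) (r - a') + dot (w + rho *: r) a') =
    rho / 2 * sqnorm2 (r + a - a').
  by rewrite mulr_ge0 ?sqnorm2_ge0// divr_ge0 ?ltW.
rewrite /edge_energy /sqnorm2 !(dotDl, dotDr, dotZl, dotZr, dotNl, dotNr).
rewrite (dotC r w) (dotC a r) (dotC a' r) (dotC a' a).
by field; rewrite gt_eqF.
Qed.
End Dot.

Lemma sum_ord_pred (V : nmodType) n (F : nat -> V) : (0 < n)%N ->
  \sum_(i < n) F i = \sum_(i < n.-1) F i + F n.-1.
Proof. by case: n => // n _; rewrite big_ord_recr. Qed.

Lemma sum_adjacent (V : nmodType) n e (F : nat -> V) : (e.+1 < n)%N ->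
  (forall d, d != e -> d != e.+1 -> F d = 0) ->
  \sum_(d < n) F d = F e + F e.+1.
Proof.
move=> en F0.
rewrite (bigD1 (Ordinal (ltnW en))) //= (bigD1 (Ordinal en)) /=; last first.
  by rewrite -val_eqE /= neq_ltn ltnSn orbT.
by rewrite addrA big1 ?addr0// => d /andP[? ?]; exact: F0.
Qed.

Lemma is_derive_quad (R : realType) (a b c t : R) :
  is_derive t 1 (fun s : R => a + s * b + s ^+ 2 * c) (b + 2 * t * c).
Proof.
pose p : {poly R} := a%:P + b *: 'X + c *: 'X^2.
have -> : (fun s : R => a + s * b + s ^+ 2 * c) = horner p.
  by apply/funext => s; rewrite /p !hornerE /=; ring.
have -> : b + 2 * t * c = p^`().[t]; last exact: is_derive_poly.
rewrite /p !(derivD, derivC, derivZ, derivX, derivXn) !hornerE /=; ring.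
Qed.

(** * The augmented Lagrangian along lines, and multipliers of the layered problem *)

Section Layered.
Context {R : realType} {D : nat} (Q : tree_problem R D).
Hypothesis D0 : (0 < D)%N.
Implicit Types (x h : primal Q) (y : dual Q) (rho : R).

Definition shift x (t : R) h : primal Q := fun d => x d + t *: h d.

Definition coupling x d : 'cV[R]_(layer_sdim Q d) :=
  layerA Q d *m x d + layerB Q d *m x d.+1.

Lemma residual_shift x t h d :
  residual (shift x t h) d = residual x d + t *: coupling h d.
Proof.
rewrite /residual /coupling /shift !mulmxDr -!scalemxAr scalerDr.
by rewrite addrACA [LHS]addrAC.
Qed.

Lemma coupling_diff x x' d :
  coupling (fun e => x e - x' e) d = residual x d - residual x' d.
Proof.
rewrite /coupling /residual !mulmxBr.
move: (_ *m x d) (_ *m x d.+1) (_ *m x' d) (_ *m x' d.+1) (layerc Q d)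
  => a b a' b' c.
by apply/colP => i; rewrite !mxE; ring.
Qed.

Lemma residual_feasible x d : (d < D.-1)%N -> feasible x -> residual x d = 0.
Proof. by move=> dD xf; apply/eqP; rewrite subr_eq0 xf. Qed.

Lemma aug_lagrangianE rho x y : aug_lagrangian rho x y =
  objective x + \sum_(d < D.-1) (dot (y d) (residual x d) +
                                 rho / 2 * sqnorm2 (residual x d)).
Proof.
rewrite /aug_lagrangian /objective (sum_ord_pred (fun d => layer_cost (x d)))//.
rewrite [RHS]addrAC [LHS]addrC -big_split /=; congr (_ + _).
by apply: eq_bigr => d _; rewrite addrA.
Qed.

Hypothesis diffc :
  forall d, (d < D)%N -> forall z, differentiable (@layer_cost R D Q d) z.

(** Fermat's rule on the line through [x] with direction [h]. No sign of [rho] is assumed, so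
    [rho = 0] and [y = 0] cover the original objective too. *)
Lemma lagrangian_stationary rho x y h :
  (forall t, aug_lagrangian rho x y <= aug_lagrangian rho (shift x t h) y) ->
  \sum_(d < D) dot (gradient (@layer_cost R D Q d) (x d)) (h d) +
  \sum_(d < D.-1) dot (y d + rho *: residual x d) (coupling h d) = 0.
Proof.
move=> minx.
pose a := \sum_(d < D.-1) (dot (y d) (residual x d) + rho / 2 * sqnorm2 (residual x d)).
pose b := \sum_(d < D.-1) dot (y d + rho *: residual x d) (coupling h d).
pose c := \sum_(d < D.-1) (rho / 2 * sqnorm2 (coupling h d)).
pose F := fun (d : 'I_D) (t : R) => layer_cost (x d + t *: h d) : R.
(* Residuals are affine in the step, so the multiplier and penalty terms form a quadratic. [L] is a
   sum of functions so that the derivative rules for sums apply. *)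
pose L := \sum_d F d + (fun s : R => a + s * b + s ^+ 2 * c).
have LE t : aug_lagrangian rho (shift x t h) y = L t.
  transitivity (\sum_d F d t + (a + t * b + t ^+ 2 * c)); last first.
    by rewrite /L fct_sumE.
  rewrite aug_lagrangianE; congr (_ + _).
  rewrite /a /b /c !mulr_sumr -!big_split /=; apply: eq_bigr => d _.
  rewrite residual_shift; move: (residual x d) (coupling h d) => r q.
  by rewrite /sqnorm2 !(dotDl, dotDr, dotZl, dotZr) [dot q r]dotC; field.
have shift0 : shift x 0 h = x.
  by apply/functional_extensionality_dep => d; rewrite /shift scale0r addr0.
have dL (t : R) : is_derive t (1 : R) (L : R -> R)
    (\sum_(d < D) dot (gradient (@layer_cost R D Q d) (shift x t h d)) (h d) +
     (b + 2 * t * c)).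
  apply: is_deriveD; last exact: is_derive_quad.
  by apply: is_derive_sum => d; apply: is_derive_line; exact: diffc.
have min0 : is_derive (0 : R) (1 : R) (L : R -> R) 0.
  (* Any open interval around 0 would do. *)
  apply: (@derive1_at_min R L (-1) 1).
  - lra.
  - by move=> t _; exact: (@ex_derive _ _ _ _ _ _ _ (dL t)).
  - by rewrite in_itv /=; lra.
  - by move=> t _; rewrite -!LE shift0.
have := @derive_val _ _ _ _ _ _ _ (dL 0).
rewrite (@derive_val _ _ _ _ _ _ _ min0) mulr0 mul0r addr0 => /esym.
by rewrite shift0.
Qed.

(** Reduces to [multipliers] by stacking all levels into a single column. *)
Lemma layer_multipliers (g : primal Q) :
  (forall h, (forall d, (d < D.-1)%N -> coupling h d = 0) ->
    \sum_(d < D) dot (g d) (h d) = 0) ->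
  exists y : dual Q, forall h,
    \sum_(d < D) dot (g d) (h d) = \sum_(d < D.-1) dot (y d) (coupling h d).
Proof.
move=> g0; pose n d := layer_dim Q d.
(* [P d] extracts level [d] from the stacked column; [conform_mx] bridges the dimensions [n e] and
   [n d], which agree only once [e = d] is known. *)
pose P d : 'M[R]_(n d, \sum_(e < D) n e) :=
  \mxrow_(e < D) (if (e : nat) == d then conform_mx 0 (1%:M : 'M[R]_(n d)) else 0).
have PE (h : primal Q) d : (d < D)%N -> P d *m (\mxcol_(e < D) h e) = h d.
  move=> dD; rewrite mul_mxrow_mxcol (bigD1 (Ordinal dD)) //= eqxx conform_mx_id.
  rewrite mul1mx big1 ?addr0// => e /negPf; rewrite -val_eqE /= => ->.
  by rewrite mul0mx.
pose C (d : 'I_D.-1) := layerA Q d *m P d + layerB Q d *m P d.+1.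
pose G := \sum_(d < D) (P d)^T *m g d.
have GE X : dot G X = \sum_(d < D) dot (g d) (P d *m X).
  rewrite /dot linear_sum mulmx_suml summxE; apply: eq_bigr => d _.
  by rewrite /= trmx_mul trmxK mulmxA.
have CE (d : 'I_D.-1) X : C d *m X = coupling (fun e => P e *m X) d.
  by rewrite /C /coupling mulmxDl !mulmxA.
have [X CX|y yG] := @multipliers _ _ _ _ C G.
  rewrite GE; apply: (g0 (fun d => P d *m X)) => d dD.
  by rewrite -(CE (Ordinal dD)) CX.
(* A [dual] is indexed by all of [nat], hence the extension by zero. *)
pose z d : 'cV[R]_(layer_sdim Q d) :=
  if pselect (d < D.-1)%N is left dD then y (Ordinal dD) else 0.
have zE (d : 'I_D.-1) : z d = y d.
  case: d => d dD; rewrite /z /=; case: pselect => [dD'|//].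
  by rewrite (bool_irrelevance dD' dD).
exists z => h.
have {yG} := yG (\mxcol_(e < D) h e); rewrite GE.
rewrite (eq_bigr (fun d : 'I_D => dot (g d) (h d))) => [->|d _]; last by rewrite PE.
apply: eq_bigr => d _; rewrite zE CE /coupling !PE//.
  by rewrite -ltn_predRL.
by rewrite (leq_trans (ltn_ord d))// leq_pred.
Qed.

(** * Optimality conditions of the forward pass *)

Definition sweep (x x' : primal Q) d : primal Q :=
  fun e => if (e < d)%N then x' e else x e.

Lemma dfwith_sweep x x' d :
  eqtype.dfwith (sweep x x' d) (x' d) = sweep x x' d.+1.
Proof.
apply/functional_extensionality_dep => e; rewrite /sweep ltnS.
have [<-|de] := eqVneq d e; first by rewrite dfwith_in leqnn.
by rewrite dfwith_out// (leq_eqVlt e d) eq_sym (negPf de).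
Qed.

Definition single d (v : 'cV[R]_(layer_dim Q d)) : primal Q :=
  eqtype.dfwith (fun=> 0) v.

(** Moving along [single v] changes block [d] only, so block minimality is minimality on that
    line. *)
Lemma block_stationary rho x x' y d (v : 'cV[R]_(layer_dim Q d)) : (d < D)%N ->
  is_block_argmin rho (sweep x x' d) y (x' d) ->
  dot (gradient (@layer_cost R D Q d) (x' d)) v +
  \sum_(e < D.-1) dot (y e + rho *: residual (sweep x x' d.+1) e)
                      (coupling (single v) e) = 0.
Proof.
move=> dD xmin.
rewrite -[RHS](@lagrangian_stationary rho (sweep x x' d.+1) y (single v)); last first.
  move=> t; rewrite -dfwith_sweep; have := xmin (x' d + t *: v).
  congr (_ <= aug_lagrangian _ _ _).
  apply/functional_extensionality_dep => e; rewrite /shift /single.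
  have [<-|de] := eqVneq d e; first by rewrite !dfwith_in.
  by rewrite !dfwith_out// scaler0 addr0.
congr (_ + _); rewrite (bigD1 (Ordinal dD)) //= /single dfwith_in {1}/sweep leqnn.
rewrite big1 ?addr0// => e; rewrite -val_eqE /= => ed.
by rewrite dfwith_out ?dot0r// eq_sym.
Qed.

(** Sum of the block conditions, regrouped by constraint. Constraint [e] is felt by the updates of
    levels [e] and [e.+1] only: the former still sees the old [x e.+1], which creates the error
    term, while the latter sees the full new residual. *)
Lemma sweep_stationary rho x x' y h :
  (forall d, (d < D)%N -> is_block_argmin rho (sweep x x' d) y (x' d)) ->
  \sum_(d < D) dot (gradient (@layer_cost R D Q d) (x' d)) (h d) +
  \sum_(e < D.-1)
    (dot (y e + rho *: residual x' e - rho *: (layerB Q e *m (x' e.+1 - x e.+1)))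
       (layerA Q e *m h e) +
     dot (y e + rho *: residual x' e) (layerB Q e *m h e.+1)) = 0.
Proof.
move=> xmin.
have S0 : \sum_(d < D) (dot (gradient (@layer_cost R D Q d) (x' d)) (h d) +
    \sum_(e < D.-1) dot (y e + rho *: residual (sweep x x' d.+1) e)
                        (coupling (single (h d)) e)) = 0.
  by apply: big1 => d _; apply: block_stationary => //; exact: xmin.
rewrite -[RHS]S0 [RHS]big_split /= [X in _ = _ + X]exchange_big /=; congr (_ + _).
apply: eq_bigr => e _.
have eD : (e.+1 < D)%N by rewrite -ltn_predRL.
pose F d := dot (y e + rho *: residual (sweep x x' d.+1) e) (coupling (single (h d)) e).
rewrite (@sum_adjacent _ _ e F eD) => [|d de de1]; last first.
  by rewrite /F /coupling /single !dfwith_out// !mulmx0 addr0 dot0r.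
rewrite /F /coupling /single !dfwith_in !dfwith_out; last 2 first.
- by rewrite neq_ltn ltnSn orbT.
- by rewrite neq_ltn ltnSn.
have -> : residual (sweep x x' e.+2) e = residual x' e.
  by rewrite /residual /sweep !ltnS leqnn leqnSn.
have -> : residual (sweep x x' e.+1) e =
    residual x' e - layerB Q e *m (x' e.+1 - x e.+1).
  rewrite /residual /sweep ltnSn ltnn mulmxBr.
  move: (_ *m x' e) (_ *m x' e.+1) (_ *m x e.+1) (layerc Q e) => a b b' c.
  by apply/colP => i; rewrite !mxE; ring.
by rewrite !mulmx0 addr0 add0r; move: (residual x' e) => r; rewrite scalerBr addrA.
Qed.

(** * Strong convexity and uniqueness of the minimizer *)

Variable alpha : nat -> R.
Hypothesis alpha0 : forall d, (d < D)%N -> 0 < alpha d.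
Hypothesis sc : forall d, (d < D)%N -> strongly_convex Q d (alpha d).

(** Adding the strong convexity inequalities for [(z, z')] and [(z', z)] cancels the costs and
    doubles the modulus. *)
Lemma gradient_monotone d z z' : (d < D)%N ->
  2 * alpha d * sqnorm2 (z - z') <=
  dot (gradient (@layer_cost R D Q d) z) (z - z') -
  dot (gradient (@layer_cost R D Q d) z') (z - z').
Proof.
move=> dD; move: (sc dD z z') (sc dD z' z).
rewrite -(opprB z z'); move: (gradient _ z) (gradient _ z') (z - z') => g g' w.
rewrite /sqnorm2 !(dotNr, dotNl) opprK; lra.
Qed.

(** Directions with zero coupling preserve feasibility, so [x] minimizes the Lagrangian with zero
    penalty and multiplier along them. *)
Lemma minimizer_stationary x h : is_minimizer x ->
  (forall d, (d < D.-1)%N -> coupling h d = 0) ->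
  \sum_(d < D) dot (gradient (@layer_cost R D Q d) (x d)) (h d) = 0.
Proof.
move=> [xf xmin] h0.
have L0 (z : primal Q) : aug_lagrangian 0 z (fun=> 0) = objective z.
  rewrite aug_lagrangianE big1 ?addr0// => d _.
  by rewrite dot0l mul0r mul0r addr0.
rewrite -[RHS](@lagrangian_stationary 0 x (fun=> 0) h); last first.
  move=> t; rewrite !L0; apply: xmin => d dD.
  by apply/eqP; rewrite -subr_eq0 -/(residual _ d) residual_shift h0// scaler0
    addr0 residual_feasible.
by rewrite [X in _ = _ + X]big1 ?addr0// => d _; rewrite scale0r addr0 dot0l.
Qed.

Lemma minimizer_unique x x' : is_minimizer x -> is_minimizer x' -> x = x'.
Proof.
move=> xmin x'min.
have [[xf xle] [x'f x'le]] := (xmin, x'min).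
have G0 : \sum_(d < D) dot (gradient (@layer_cost R D Q d) (x' d)) (x d - x' d) = 0.
  apply: (minimizer_stationary (h := fun d => x d - x' d)) => // d dD.
  by rewrite coupling_diff !residual_feasible// subrr.
have S0 : \sum_(d < D) alpha d * sqnorm2 (x d - x' d) <= 0.
  have H : \sum_(d < D) (dot (gradient (@layer_cost R D Q d) (x' d)) (x d - x' d) +
      alpha d * sqnorm2 (x d - x' d)) <=
      \sum_(d < D) (layer_cost (x d) - layer_cost (x' d)).
    by apply: ler_sum => d _; exact: sc.
  move: H; rewrite big_split /= G0 add0r sumrB => H; apply: (le_trans H).
  by rewrite subr_le0; exact: xle.
(* Equality is required at every natural index; levels from [D] on have no nodes, so their vectors
   have dimension zero. *)
apply/functional_extensionality_dep => d; have [dD|Dd] := ltnP d D; last first.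
  have w0 : width Q d = 0%N.
    by apply/eqP; rewrite -leqn0 leqNgt width_gt0 -leqNgt.
  have A0 (A : {set node Q d}) : #|A| = 0%N.
    by apply/eqP; rewrite -leqn0 -w0 -[leqRHS]card_ord max_card.
  have n0 : layer_dim Q d = 0%N.
    by rewrite /layer_dim /pdim /ldim !big1// => k _;
      have := leq_trans (ltn_ord k) (eq_leq (A0 _)).
  by apply/colP => i; have := leq_trans (ltn_ord i) (eq_leq n0).
apply/eqP; rewrite -subr_eq0; apply/eqP; apply: sqnorm2_eq0.
have a0 : 0 < alpha d by exact: alpha0.
rewrite -(ler_pM2l a0) mulr0 (le_trans _ S0)//.
rewrite (bigD1 (Ordinal dD)) //= lerDl sumr_ge0// => e _.
by rewrite mulr_ge0 ?sqnorm2_ge0// ltW// alpha0.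
Qed.

(** * Lyapunov decrease and convergence *)

(* [u] is minus the multiplier of the paper. *)
Definition lyapunov rho (xs : primal Q) (u : dual Q) x y : R :=
  \sum_(e < D.-1)
    edge_energy rho (y e + u e) (layerB Q e *m (x e.+1 - xs e.+1)).

Lemma lyapunov_ge0 rho xs u x y : 0 < rho -> 0 <= lyapunov rho xs u x y.
Proof.
by move=> rho0; apply: sumr_ge0 => e _; exact: edge_energy_ge0.
Qed.

(** Monotonicity is tested on [h = x' - xs]; the sweep condition and [kkt] turn the gradient terms
    into a sum over constraints, which [edge_decrease] bounds one by one. *)
Lemma lyapunov_decrease rho xs (u : dual Q) x x' y y' : 0 < rho -> feasible xs ->
  (forall h, \sum_(d < D) dot (gradient (@layer_cost R D Q d) (xs d)) (h d) =
             \sum_(d < D.-1) dot (u d) (coupling h d)) ->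
  (forall d, (d < D)%N -> is_block_argmin rho (sweep x x' d) y (x' d)) ->
  (forall d, (d < D.-1)%N -> y' d = y d + rho *: residual x' d) ->
  \sum_(d < D) 2 * alpha d * sqnorm2 (x' d - xs d) <=
  lyapunov rho xs u x y - lyapunov rho xs u x' y'.
Proof.
move=> rho0 xsf kkt xmin yE.
pose h : primal Q := fun d => x' d - xs d.
have rE e : (e < D.-1)%N -> coupling h e = residual x' e.
  by move=> eD; rewrite coupling_diff (residual_feasible eD xsf) subr0.
have mono : \sum_(d < D) 2 * alpha d * sqnorm2 (h d) <=
    \sum_(d < D) (dot (gradient (@layer_cost R D Q d) (x' d)) (h d) -
      dot (gradient (@layer_cost R D Q d) (xs d)) (h d)).
  by apply: ler_sum => d _; exact: gradient_monotone.
apply: (le_trans mono); rewrite sumrB [X in _ - X]kkt.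
have /eqP := sweep_stationary h xmin; rewrite addr_eq0 => /eqP ->.
rewrite -opprD -big_split -sumrN /lyapunov -sumrB; apply: ler_sum => e _ /=.
rewrite yE// rE//.
have -> : layerA Q e *m h e = residual x' e - layerB Q e *m h e.+1.
  by rewrite -rE// /coupling addrK.
have -> : x' e.+1 - x e.+1 = h e.+1 - (x e.+1 - xs e.+1).
  by rewrite /h opprB addrA subrK.
rewrite [layerB Q e *m (h e.+1 - _)]mulmxBr -/(h e.+1).
move: (residual x' e) (_ *m h e.+1) (_ *m (x e.+1 - xs e.+1)) => r a' a.
rewrite [y e + _ + u e]addrAC; apply: (le_trans _ (edge_decrease _ _ _ _ rho0)).
(* The [kkt] term [dot (u e) r] splits along [r = (r - a') + a'] and joins the two pairings, so the
   sides are equal. *)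
rewrite lerN2 le_eqVlt; apply/orP; left; apply/eqP.
rewrite !(dotDl, dotDr, dotZl, dotZr, dotNl, dotNr); ring.
Qed.

Lemma hADMM_cvg rho xs (x : nat -> primal Q) (y : nat -> dual Q) d :
  0 < rho -> is_minimizer xs -> hADMM rho x y -> (d < D)%N ->
  (fun k => x k d) @ \oo --> xs d.
Proof.
move=> rho0 xsmin run dD.
have [u kkt] := @layer_multipliers
  (fun d => gradient (@layer_cost R D Q d) (xs d))
  (fun h => @minimizer_stationary xs h xsmin).
pose V k := lyapunov rho xs u (x k) (y k).
have dec k : \sum_(d < D) 2 * alpha d * sqnorm2 (x k.+1 d - xs d) <= V k - V k.+1.
  have [xmin yE] := run k.
  by apply: lyapunov_decrease => //; exact: (proj1 xsmin).
have a0 : 0 < 2 * alpha d by rewrite mulr_gt0// alpha0.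
(* The decrease controls [x k.+1]; the arbitrary initial point is dropped. *)
rewrite -(cvg_shiftS (fun k => x k d)); apply: cvg_sqnorm2.
apply: (@cvg0_of_bounded_sum _ _ (V 0 / (2 * alpha d))) => [k|n].
  exact: sqnorm2_ge0.
rewrite ler_pdivlMr// mulr_suml.
(* The decreases telescope, keeping only the term of level [d] among nonnegative ones. *)
have : \sum_(k < n) sqnorm2 (x k.+1 d - xs d) * (2 * alpha d) <= V 0 - V n.
  elim: n => [|n IH]; first by rewrite big_ord0 subrr.
  rewrite big_ord_recr /= -[leRHS](subrKA (V n)) lerD//; apply: le_trans _ (dec n).
  rewrite (bigD1 (Ordinal dD)) //= mulrC lerDl sumr_ge0// => e _.
  by rewrite !mulr_ge0 ?sqnorm2_ge0// ltW// alpha0.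
by move=> /le_trans; apply; rewrite gerBl lyapunov_ge0.
Qed.
End Layered.

Theorem theorem2 (R : realType) (D : nat) (hD : (2 <= D)%N)
    (Q : tree_problem R D) (rho : R) (hrho : 0 < rho) (alpha : nat -> R)
    (hslater : exists x : primal Q, strictly_feasible x)
    (hopt : exists x : primal Q, is_minimizer x)
    (hdiff : forall d, (d < D)%N ->
       forall z, differentiable (@layer_cost R D Q d) z)
    (halpha : forall d, (d < D)%N -> 0 < alpha d)
    (hsc : forall d, (d < D)%N -> strongly_convex Q d (alpha d)) :
  exists xs : primal Q,
    unique (@is_minimizer R D Q) xs /\
    forall (x : nat -> primal Q) (y : nat -> dual Q),
      hADMM rho x y ->
      forall d, (d < D)%N -> (fun k => x k d) @ \oo --> xs d.
Proof.
have D0 : (0 < D)%N by exact: ltnW.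
have [xs xsmin] := hopt; exists xs; split.
  by split=> // x' x'min; exact: (minimizer_unique D0 hdiff halpha hsc).
move=> x y run d dD.
exact: (hADMM_cvg D0 hdiff halpha hsc hrho xsmin run dD).
Qed.
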